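(* Let $G=(V,E)$ be a finite simple hypergraph on the vertex set $V=\{x_1,\dots,x_n\}$ with nonempty edges $e_1,\dots,e_m$, let $A$ be its $n\times m$ incidence matrix, let $G^*$ be its dual hypergraph, and let $I(G)\subseteq S=K[x_1,\dots,x_n]$ be its edge ideal, where $K$ is a field. For $\mathbf{c}\in\mathbb{Z}^n_{\ge 0}$ consider the dual linear programming system $$\max\{\langle \mathbf{1},\mathbf{y}\rangle \mid \mathbf{y}\in\mathbb{R}^m_{\ge 0},\ A\mathbf{y}\le \mathbf{c}\}=\min\{\langle \mathbf{c},\mathbf{z}\rangle \mid \mathbf{z}\in\mathbb{R}^n_{\ge 0},\ A^{\mathrm{T}}\mathbf{z}\ge \mathbf{1}\}.$$ Then the following conditions are equivalent: (1) this dual system has integral optimal solutions $\mathbf{y}$ and $\mathbf{z}$ for all nonnegative integral vectors $\mathbf{c}\in\mathbb{Z}^n_{\ge 0}$; (2) the algebra $\mathcal{R}_s(I(G))=\mathcal{A}(G^* )$ is a standard graded algebra; (3) $I(G)^{(q)}=I(G)^q$ for all $q\ge 0$.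
   Context: A hypergraph is a pair $(V,E)$ with $E\subseteq 2^V$; it is simple if no edge contains another edge. The incidence matrix $A$ of $G$ has $(i,j)$-entry $1$ if $x_i\in e_j$ and $0$ otherwise. Here $\mathbf{1}$ denotes the all-ones vector of the appropriate length, $\langle\cdot,\cdot\rangle$ the standard inner product, and inequalities between vectors are componentwise. A set of vertices is identified with the squarefree monomial that is the product of its elements. The edge ideal is $I(G)=(e : e\in E)\subseteq S$. A vertex cover of $G$ is a set of vertices meeting every edge of $G$; it is minimal if no proper subset is a vertex cover. The dual hypergraph $G^*$ is the hypergraph on $V$ whose edges are the minimal vertex covers of $G$; equivalently, $I(G^* )$ is the Alexander dual $I(G)^\vee=\bigcap_{e\in E}(x_i : x_i\in e)$. For a squarefree monomial ideal $I$, the $q$-th symbolic power is $I^{(q)}=\bigcap_{\mathfrak{p}\in\operatorname{Ass}(S/I)}\mathfrak{p}^q$. The symbolic Rees algebra of $I$ is $\mathcal{R}_s(I)=\bigoplus_{q\ge 0}I^{(q)}t^q\subseteq S[t]$. For a hypergraph $H=(V,E(H))$, a vector $\mathbf{c}=(c_1,\dots,c_n)\in\mathbb{Z}^n_{\ge 0}$ is a $k$-cover of $H$ if $\sum_{x_i\in e}c_i\ge k$ for every edge $e$ of $H$. The vertex cover algebra is $\mathcal{A}(H)=\bigoplus_{k\ge 0}\mathcal{A}_k(H)$, where $\mathcal{A}_k(H)$ is the $K$-vector space spanned by all monomials $x_1^{c_1}\cdots x_n^{c_n}t^k$ such that $(c_1,\dots,c_n)$ is a $k$-cover of $H$. The algebras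 $\mathcal{R}_s(I(G))$ and $\mathcal{A}(G^* )$ coincide as graded subalgebras of $S[t]$, graded by the degree in $t$. Such an algebra is standard graded if it is generated, as an algebra over its degree-$0$ part $S$, by its elements of degree $1$ in $t$. *)

(* Defs.v *)
From mathcomp Require Import all_boot all_order all_algebra.
From mathcomp Require Import mpoly.
From mathcomp Require Import classical_sets reals.

Set Implicit Arguments.
Unset Strict Implicit.
Unset Printing Implicit Defensive.

Import Order.TTheory GRing.Theory Num.Theory.
Local Open Scope classical_set_scope.
Local Open Scope ring_scope.

(* A hypergraph on the vertices x_0, ..., x_(n-1) is its edge set
   E : {set {set 'I_n}}. *)
Section Hypergraph.
Variable n : nat.
Implicit Types (E H : {set {set 'I_n}}) (C e : {set 'I_n}).

Definition simple_hypergraph E : Prop :=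
  {in E &, forall e e', e \subset e' -> e = e'}.

Definition vertex_cover E C : bool :=
  [forall e in E, e :&: C != finset.set0].

Definition dual_hypergraph E : {set {set 'I_n}} :=
  [set C : {set 'I_n} | minset (vertex_cover E) C]%SET.

Definition kcover H (k : nat) (c : 'X_{1..n}) : Prop :=
  forall e, e \in H -> (k <= \sum_(i in e) c i)%N.

(* The edges e_1, ..., e_m are listed by enum_val. *)
Definition incidence_mx (R : pzRingType) E : 'M[R]_(n, #|E|) :=
  \matrix_(i, j) (i \in (enum_val j : {set 'I_n}))%:R.

End Hypergraph.

Section LinearProgram.
Variable R : realType.

Definition dotv k (u v : 'cV[R]_k) : R := \sum_i u i 0 * v i 0.

Definition lev k (u v : 'cV[R]_k) : Prop := forall i, u i 0 <= v i 0.

Definition onev k : 'cV[R]_k := const_mx 1.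

Definition integralv k (u : 'cV[R]_k) : Prop :=
  forall i, u i 0 \is a Num.int.

Variables (n m : nat) (A : 'M[R]_(n, m)) (c : 'cV[R]_n).

Definition max_feasible : set 'cV[R]_m :=
  [set y | lev 0 y /\ lev (A *m y) c].

Definition max_optimal (y : 'cV[R]_m) : Prop :=
  max_feasible y /\
  forall y', max_feasible y' -> dotv (onev m) y' <= dotv (onev m) y.

Definition min_feasible : set 'cV[R]_n :=
  [set z | lev 0 z /\ lev (onev m) (A^T *m z)].

Definition min_optimal (z : 'cV[R]_n) : Prop :=
  min_feasible z /\
  forall z', min_feasible z' -> dotv c z <= dotv c z'.

End LinearProgram.

Definition integral_dual_system (R : realType) n (E : {set {set 'I_n}}) : Prop :=
  forall c : 'I_n -> nat,
    let A := incidence_mx R E in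
    let cv : 'cV[R]_n := \col_i (c i)%:R in
    (exists y, max_optimal A cv y /\ integralv y) /\
    (exists z, min_optimal A cv z /\ integralv z).

Section Ideals.
Variable S : comNzRingType.
Implicit Types (I J P : set S) (X : set S).

Definition is_ideal I : Prop :=
  [/\ I 0, forall a b, I a -> I b -> I (a + b) & forall a b, I b -> I (a * b)].

Definition is_prime_ideal P : Prop :=
  [/\ is_ideal P, ~ P 1 & forall a b, P (a * b) -> P a \/ P b].

Definition ideal_gen X : set S := smallest is_ideal X.

Definition ideal_mul I J : set S := ideal_gen [set a * b | a in I & b in J].

Definition ideal_pow I (q : nat) : set S := iter q (ideal_mul I) setT.

(* [set a | I (a * f)] is the annihilator of the class of f in S/I. *)
Definition assoc_primes I : set (set S) :=
  [set P | is_prime_ideal P /\ exists f, P = [set a | I (a * f)]].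

Definition symbolic_pow I (q : nat) : set S :=
  \bigcap_(P in assoc_primes I) ideal_pow P q.

End Ideals.

Section GradedAlgebras.
Variable S : comNzRingType.

(* The direct sum of the F q * t^q inside S[t], where t is 'X. *)
Definition graded_sum (F : nat -> set S) : set {poly S} :=
  [set f | forall q, F q f`_q].

Definition is_subalgebra (B : set {poly S}) : Prop :=
  [/\ B 1, forall f g, B f -> B g -> B (f + g),
      forall f g, B f -> B g -> B (f * g) & forall a f, B f -> B (a *: f)].

Definition degree1_part (B : set {poly S}) : set {poly S} :=
  [set f | B f /\ exists a, f = a *: 'X].

(* For a graded B, equality also forces the degree-0 part of B to be S. *)
Definition standard_graded (B : set {poly S}) : Prop :=
  B = smallest is_subalgebra (degree1_part B).

Definition symbolic_Rees (I : set S) : set {poly S} :=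
  graded_sum (symbolic_pow I).

End GradedAlgebras.

Definition is_subspace (K : fieldType) (V : lmodType K) (W : set V) : Prop :=
  [/\ W 0, forall u v, W u -> W v -> W (u + v) & forall a u, W u -> W (a *: u)].

Section EdgeIdeal.
Variables (K : fieldType) (n : nat).

Definition edge_ideal (E : {set {set 'I_n}}) : set {mpoly K[n]} :=
  ideal_gen [set f | exists2 e, e \in E & f = \prod_(i in e) 'X_i].

(* The coefficients of t^k of the elements of A_k(H). *)
Definition cover_space (H : {set {set 'I_n}}) (k : nat) : set {mpoly K[n]} :=
  smallest (@is_subspace K {mpoly K[n]})
    [set f | exists2 c, kcover H k c & f = 'X_[c]].

Definition vertex_cover_algebra (H : {set {set 'I_n}}) : set {poly {mpoly K[n]}} :=
  graded_sum (cover_space H).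

End EdgeIdeal.

Arguments edge_ideal K {n} E.
Arguments vertex_cover_algebra K {n} H.

(* Main.v *)
(* The minimal primes of I(G) are the ideals P_C = (x_i : i in C) for C a minimal
   vertex cover, and they are its only associated primes.  Every ideal involved
   is monomial: x^c lies in I(G)^(q) iff c is a q-cover of G^*, and x^c lies in
   I(G)^q iff q edges, counted with repetition, can be packed into c.  So (3)
   says that every q-cover of G^* packs q edges, and it is equivalent to (2)
   because the degree one part of the symbolic Rees algebra is I(G) t.

   If q-covers pack q edges, then for given c a minimal vertex cover of least
   weight and a packing of that many edges are integral solutions of equal
   value, hence optimal by weak duality.

   Conversely, let f(c) be the largest number of edges that can be packed into
   c.  An integral optimal y for every c gives f(Nc) = N f(c), so f is a
   superadditive, homogeneous, N-valued function.  Replacing f successively by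
   its derivatives sup_N (f(x + Nd) - N f(d)), which take values in N and
   dominate f, in the directions d = c, u_1, ..., u_n (u_i being the unit
   vectors) makes it additive: there is an integral z with f(x) <= <x, z> for
   all x and equality at x = c.  The support of z is a vertex cover of weight at
   most f(c).  Thus no LP duality beyond the weak form is needed. *)
Require Import Defs.
From mathcomp Require Import all_boot all_order all_algebra.
From mathcomp Require Import mpoly.
From mathcomp Require Import boolp classical_sets reals.
From mathcomp Require Import zify.

Set Implicit Arguments.
Unset Strict Implicit.
Unset Printing Implicit Defensive.

Import Order.TTheory GRing.Theory Num.Theory.
Local Open Scope classical_set_scope.
Local Open Scope ring_scope.

(** * Ideals, their powers and their symbolic powers *)

Section IdealTheory.
Variable S : comNzRingType.
Implicit Types (I J P : set S) (X : set S).

Lemma ideal_gen_is_ideal X : is_ideal (ideal_gen X).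
Proof.
split=> [J [[] //]|a b Ia Ib J JP|a b Ib J JP].
  by case: (JP) => -[_ JD _] _; apply: JD; [apply: Ia|apply: Ib].
by case: (JP) => -[_ _ JM] _; apply: JM; apply: Ib.
Qed.

Lemma ideal_gen_sub X I : is_ideal I -> X `<=` I -> ideal_gen X `<=` I.
Proof. exact: smallest_sub. Qed.

Lemma ideal_pow_is_ideal I q : is_ideal (ideal_pow I q).
Proof. by case: q => [|q] //; apply: ideal_gen_is_ideal. Qed.

Lemma ideal_sum I (T : eqType) (s : seq T) (F : T -> S) :
  is_ideal I -> {in s, forall t, I (F t)} -> I (\sum_(t <- s) F t).
Proof.
case=> I0 ID _ IF; rewrite big_seq.
by elim/big_rec: _ => // t a ts Ia; apply: ID => //; apply: IF.
Qed.

Lemma ideal_pow1 I : is_ideal I -> ideal_pow I 1 = I.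
Proof.
move=> II; have [_ _ IM] := II; apply/seteqP; split.
  by apply: ideal_gen_sub => // _ [a Ia [b _ <-]]; rewrite mulrC; apply: IM.
by move=> a Ia; apply: sub_gen_smallest; exists a => //; exists 1; rewrite ?mulr1.
Qed.

(** Induction on [p]: the elements [x] with [x * b] in the power [p.+1 + q] form an ideal, so only
    the products generating [ideal_pow I p.+1] have to be checked. *)
Lemma ideal_powD I p q a b :
  ideal_pow I p a -> ideal_pow I q b -> ideal_pow I (p + q)%N (a * b).
Proof.
have [_ _ powM] := ideal_pow_is_ideal I (p + q).
elim: p a b powM => [|p IHp] a b powM Ia Ib; first exact: powM.
pose J := [set x | ideal_pow I (p.+1 + q)%N (x * b)].
have [I0 ID IM] := ideal_pow_is_ideal I (p.+1 + q).
suff /(_ a Ia) : ideal_pow I p.+1 `<=` J by [].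
apply: ideal_gen_sub.
  split=> [|x y Jx Jy|x y Jy]; rewrite /J /=; first by rewrite mul0r.
    by rewrite mulrDl; apply: ID.
  by rewrite -mulrA; apply: IM.
move=> _ [x Ix [y Iy <-]]; rewrite /J /= -mulrA.
apply: sub_gen_smallest; exists x => //; exists (y * b) => //.
by apply: IHp => //; have [_ _] := ideal_pow_is_ideal I (p + q).
Qed.

Lemma symbolic_pow_is_ideal I q : is_ideal (symbolic_pow I q).
Proof.
split=> [P _|a b Ia Ib P IP|a b Ib P IP]; have [P0 PD PM] := ideal_pow_is_ideal P q.
- exact: P0.
- by apply: PD; [exact: Ia|exact: Ib].
- by apply: PM; apply: Ib.
Qed.

Lemma symbolic_powD I p q a b :
  symbolic_pow I p a -> symbolic_pow I q b -> symbolic_pow I (p + q)%N (a * b).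
Proof. by move=> Ia Ib P IP; apply: ideal_powD; [exact: Ia|exact: Ib]. Qed.

Lemma symbolic_pow0 I : symbolic_pow I 0 = setT.
Proof. by apply/seteqP; split. Qed.

Lemma prime_ideal_prod P (T : eqType) (s : seq T) (F : T -> S) :
  is_prime_ideal P -> P (\prod_(t <- s) F t) -> exists2 t, t \in s & P (F t).
Proof.
move=> [_ P1 PM]; elim: s => [|t s IHs]; first by rewrite big_nil => /P1.
rewrite big_cons => /PM[Pt|/IHs[u us Pu]]; first by exists t; rewrite ?mem_head.
by exists u; rewrite // inE us orbT.
Qed.

End IdealTheory.

(** * Graded subalgebras of S[t] and generation in degree one *)

Section StandardGraded.
Variable S : comNzRingType.
Variable F : nat -> set S.
Hypothesis F0 : F 0%N = setT.
Hypothesis F_ideal : forall q, is_ideal (F q).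
Hypothesis FD : forall p q a b, F p a -> F q b -> F (p + q)%N (a * b).

Lemma graded_sum_is_subalgebra : is_subalgebra (graded_sum F).
Proof.
split=> [q|f g Ff Fg q|f g Ff Fg q|a f Ff q].
- rewrite coef1; case: q => [|q]; first by rewrite F0.
  by case: (F_ideal q.+1).
- by rewrite coefD; case: (F_ideal q) => _ D _; apply: D.
- rewrite coefM; apply: ideal_sum => // i _.
  by have := FD (Ff i) (Fg (q - i)%N); rewrite subnKC // -ltnS.
- by rewrite coefZ; case: (F_ideal q) => _ _ M; apply: M.
Qed.

Lemma subalgebra_pow (B : set {poly S}) I q a : is_subalgebra B ->
  (forall b, I b -> B (b *: 'X)) -> ideal_pow I q a -> B (a *: 'X^q).
Proof.
move=> [B1 BD BM BZ] BX; elim: q a => [|q IHq] a; first by move=> _; apply: BZ.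
suff: ideal_pow I q.+1 `<=` [set a | B (a *: 'X^(q.+1))] by apply.
apply: ideal_gen_sub.
  (* [is_subalgebra] does not list 0, which is reached as the multiple of 1 by the scalar 0. *)
  split=> [|b c Bb Bc|b c Bc] /=; first by rewrite scale0r -(scale0r 1); apply: BZ.
    by rewrite scalerDl; apply: BD.
  by rewrite -scalerA; apply: BZ.
move=> _ [b Ib [c Ic <-]] /=.
by rewrite exprS -scalerA scalerAr scalerAl; apply: BM; [exact: BX|exact: IHq].
Qed.

(** The sum of the powers of [F 1] is itself a subalgebra containing the degree-one part, so
    generation in degree one forces [F q] into the [q]-th power of [F 1]. The other inclusion is the
    multiplicativity of [F]. *)
Lemma standard_graded_sumP :
  standard_graded (graded_sum F) <-> forall q, F q = ideal_pow (F 1%N) q.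
Proof.
have FX a : F 1%N a -> graded_sum F (a *: 'X).
  move=> Fa q; rewrite coefZ coefX; case: (q =P 1%N) => [->|_].
    by rewrite mulr1.
  by rewrite mulr0; case: (F_ideal q).
have FXn q a : F q a -> graded_sum F (a *: 'X^q).
  move=> Fa p; rewrite coefZ coefXn; case: (p =P q) => [->|_].
    by rewrite mulr1.
  by rewrite mulr0; case: (F_ideal p).
split=> [sgF q|Fpow].
  apply/seteqP; split=> a; last first.
    move=> /(subalgebra_pow graded_sum_is_subalgebra FX) /(_ q).
    by rewrite coefZ coefXn eqxx mulr1.
  move=> /FXn; rewrite sgF => Ba.
  suff /(_ _ Ba q) :
      smallest (@is_subalgebra S) (degree1_part (graded_sum F)) `<=`
      graded_sum (ideal_pow (F 1%N)).
    by rewrite coefZ coefXn eqxx mulr1.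
  apply: smallest_sub.
    split=> [p|f g Ff Fg p|f g Ff Fg p|b f Ff p].
    - rewrite coef1; case: p => [|p] //.
      by case: (ideal_pow_is_ideal (F 1%N) p.+1).
    - by rewrite coefD; case: (ideal_pow_is_ideal (F 1%N) p) => _ D _; apply: D.
    - rewrite coefM; apply: ideal_sum => [|i _]; first exact: ideal_pow_is_ideal.
      by have := ideal_powD (Ff i) (Fg (p - i)%N); rewrite subnKC // -ltnS.
    - by rewrite coefZ; case: (ideal_pow_is_ideal (F 1%N) p) => _ _ M; apply: M.
  move=> f [Ff [b fE]] p; subst f.
  have := Ff 1%N; rewrite !coefZ !coefX eqxx mulr1 => Fb.
  case: (p =P 1%N) => [->|_]; first by rewrite mulr1 ideal_pow1.
  by rewrite mulr0; case: (ideal_pow_is_ideal (F 1%N) p).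
apply/seteqP; split; last first.
  by apply: smallest_sub; [exact: graded_sum_is_subalgebra|move=> f []].
move=> f Ff B [Balg BX]; have [B1 BD BM BZ] := Balg.
rewrite -[f]coefK poly_def.
elim/big_rec: _ => [|i g _ Bg]; first by rewrite -(scale0r 1); apply: BZ.
apply: BD => //; apply: (@subalgebra_pow B (F 1%N)) => //; last by rewrite -Fpow.
by move=> b Fb; apply: BX; split; [exact: FX|exists b].
Qed.

End StandardGraded.

(** * Monomial ideals and the primes generated by variables *)

Section MonomialIdeals.
Variables (K : fieldType) (n : nat).
Implicit Types (M N : 'X_{1..n} -> Prop) (C e : {set 'I_n}).

Definition monomial_ideal M : set {mpoly K[n]} :=
  [set f | forall m, m \in msupp f -> M m].

Definition upward_closed M := forall (a m : 'X_{1..n}), M m -> M (a + m)%MM.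

Lemma monomial_idealX M m : monomial_ideal M 'X_[m] <-> M m.
Proof.
split=> [|Mm m']; first by apply; rewrite msuppX mem_head.
by rewrite msuppX inE => /eqP ->.
Qed.

Lemma monomial_ideal_is_ideal M : upward_closed M -> is_ideal (monomial_ideal M).
Proof.
move=> upM; split=> [m|f g Mf Mg m /msuppD_le|f g Mg m /msuppM_le].
- by rewrite msupp0.
- by rewrite mem_cat => /orP[/Mf|/Mg].
- by case/allpairsP=> -[a b] [_ /Mg Mb ->]; apply: upM.
Qed.

Lemma monomial_ideal_sub M I : is_ideal I ->
  (forall m, M m -> I 'X_[m]) -> monomial_ideal M `<=` I.
Proof.
move=> II IM f Mf; rewrite [f]mpolyE; apply: ideal_sum => // m /Mf /IM Im.
by rewrite -mul_mpolyC; case: II => _ _; apply.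
Qed.

Lemma eq_monomial_ideal M N : (forall m, M m <-> N m) ->
  monomial_ideal M = monomial_ideal N.
Proof. by move=> MN; congr monomial_ideal; apply/predeqP. Qed.

Lemma ideal_mul_monomial M N : upward_closed M ->
  ideal_mul (monomial_ideal M) (monomial_ideal N) =
  monomial_ideal (fun m => exists a b, [/\ M a, N b & m = (a + b)%MM]).
Proof.
move=> upM; apply/seteqP; split.
  apply: ideal_gen_sub.
    apply: monomial_ideal_is_ideal => c _ [a [b [Ma Nb ->]]].
    by exists (c + a)%MM, b; split=> //; [exact: upM|rewrite addmA].
  move=> _ [f Mf [g Ng <-]] m /msuppM_le /allpairsP[[a b] /= [fa gb ->]].
  by exists a, b; split; [exact: Mf|exact: Ng|].
apply: monomial_ideal_sub; first exact: ideal_gen_is_ideal.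
move=> _ [a [b [Ma Nb ->]]]; rewrite mpolyXD; apply: sub_gen_smallest.
exists 'X_[a]; first exact/monomial_idealX.
by exists 'X_[b]; first exact/monomial_idealX.
Qed.

Definition weight C (m : 'X_{1..n}) := (\sum_(i in C) m i)%N.

Lemma weightD C a b : weight C (a + b)%MM = (weight C a + weight C b)%N.
Proof. by rewrite -big_split; apply: eq_bigr => i _; rewrite mnmDE. Qed.

Lemma weight_up C q : upward_closed (fun m => (q <= weight C m)%N).
Proof. by move=> a m; rewrite weightD => /leq_trans; apply; rewrite leq_addl. Qed.

Lemma weight_gt0P C (m : 'X_{1..n}) :
  reflect (exists2 i, i \in C & (0 < m i)%N) (0 < weight C m)%N.
Proof.
rewrite lt0n sum_nat_eq0 negb_forall_in.
by apply: (iffP exists_inP) => -[i iC mi]; exists i; rewrite // ?lt0n // -lt0n.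
Qed.

(** This is the ideal generated by the variables ['X_i] with [i] in [C]. *)
Definition cover_prime C := monomial_ideal (fun m => (0 < weight C m)%N).

(** A variable of [C] dividing the monomial can be split off, which lowers the weight by exactly
    one. *)
Lemma cover_prime_pow C q :
  ideal_pow (cover_prime C) q = monomial_ideal (fun m => (q <= weight C m)%N).
Proof.
elim: q => [|q IHq]; first by apply/seteqP; split.
rewrite /ideal_pow iterS [iter q _ _]IHq ideal_mul_monomial; last exact: weight_up.
apply: eq_monomial_ideal => m; split=> [[a [b [wa wb ->]]]|wm].
  by rewrite weightD -add1n leq_add.
have /weight_gt0P[i iC mi] : (0 < weight C m)%N by apply: leq_trans wm.
have Um : (U_(i) <= m)%MM.
  by apply/mnm_lepP => j; rewrite mnm1E; case: eqP => // <-.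
have wU : weight C U_(i)%MM = 1%N.
  rewrite /weight (bigD1 i) //= mnm1E eqxx big1 // => j /andP[_ ji].
  by rewrite mnm1E eq_sym (negbTE ji).
exists U_(i)%MM, (m - U_(i))%MM; split; first by rewrite wU.
- by move: wm; rewrite -{1}(submK Um) weightD wU addn1 ltnS.
- by rewrite addmC submK.
Qed.

(** Setting the variables of [C] to 0 is a ring morphism with kernel [cover_prime C]; since the
    polynomial ring is a domain, that kernel is prime. *)
Definition kill C : {mpoly K[n]} -> {mpoly K[n]} :=
  comp_mpoly [tuple if i \in C then 0 else 'X_i | i < n].

Lemma killX C m : kill C 'X_[m] = if weight C m == 0%N then 'X_[m] else 0.
Proof.
rewrite /kill comp_mpolyX; case: ifPn => [w0|].
  rewrite mpolyXE_id; apply: eq_bigr => i _; rewrite tnth_mktuple.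
  case: ifP => // iC; move: w0; rewrite sum_nat_eq0 => /forall_inP/(_ i iC)/eqP->.
  by rewrite !expr0.
rewrite -lt0n => /weight_gt0P[i iC mi].
by rewrite (bigD1 i) //= tnth_mktuple iC expr0n gtn_eqF // mul0r.
Qed.

Lemma mcoeff_kill C f m : (kill C f)@_m = if weight C m == 0%N then f@_m else 0.
Proof.
rewrite {1}[f]mpolyE /kill (raddf_sum (comp_mpoly _)) /= (raddf_sum (mcoeff m)) /=.
under eq_bigr => a _ do rewrite comp_mpolyZ mcoeffZ [_ \mPo _]killX.
rewrite (eq_bigr (fun a => if weight C m == 0%N then f@_a * 'X_[a]@_m else 0)).
  case: ifP => _; last by rewrite big1.
  by rewrite [in RHS](mpolyE f) (raddf_sum (mcoeff m)); apply: eq_bigr => a _ /=; rewrite mcoeffZ.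
move=> a _; rewrite mcoeffX; have [->|am] := eqVneq a m.
  by case: ifP => _; rewrite ?mcoeffX ?eqxx // mcoeff0 mulr0.
by case: ifP => _; rewrite ?mcoeffX ?(negbTE am) ?mcoeff0 ?mulr0 ?if_same.
Qed.

Lemma cover_primeP C f : cover_prime C f <-> kill C f = 0.
Proof.
split=> [Cf|f0 m].
  apply/mpolyP => m; rewrite mcoeff_kill mcoeff0; case: ifP => // /eqP w0.
  by apply: memN_msupp_eq0; apply/negP => /Cf; rewrite w0.
rewrite mcoeff_msupp lt0n; apply: contra => w0.
by have := mcoeff_kill C f m; rewrite f0 mcoeff0 w0 => <-.
Qed.

Lemma cover_prime_prime C : is_prime_ideal (cover_prime C).
Proof.
split; first by apply: monomial_ideal_is_ideal; apply: weight_up.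
- move/cover_primeP/eqP; rewrite /kill comp_mpoly1 => /eqP.
  by apply/eqP; rewrite oner_neq0.
- move=> f g /cover_primeP; rewrite /kill rmorphM => /eqP.
  by rewrite mulf_eq0 => /orP[]/eqP H; [left|right]; apply/cover_primeP.
Qed.

End MonomialIdeals.
Arguments cover_prime K {n} C.

(** * Edge ideals: associated primes, powers and symbolic powers *)

Section EdgeIdealPowers.
Variables (K : fieldType) (n : nat) (E : {set {set 'I_n}}).
Hypothesis edges_nonempty : forall e : {set 'I_n}, e \in E -> e != finset.set0.
Implicit Types (C e : {set 'I_n}) (m : 'X_{1..n}).

(** A cover is minimal at [i] when deleting [i] leaves some edge uncovered, and such an edge meets
    the cover in [i] alone. *)
Lemma dual_hypergraphP C :
  reflect (vertex_cover E C /\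
           forall i, i \in C -> exists2 e, e \in E & e :&: C = [set i]%SET)
    (C \in dual_hypergraph E).
Proof.
rewrite inE; apply: (iffP idP) => [/minsetP[covC minC]|[covC minC]].
  split=> // i iC.
  have : ~~ vertex_cover E (C :\ i).
    apply/negP => /minC -/(_ (subD1set _ _)) Ci.
    by move: iC; rewrite -Ci !inE eqxx.
  rewrite negb_forall_in => /exists_inP[e eE]; rewrite negbK => /eqP e0.
  exists e => //; apply/setP => j; rewrite !inE; have [->|ji] := eqVneq j i.
    have /set0Pn[k] := forall_inP covC e eE; rewrite !inE => /andP[ke kC].
    move/setP/(_ k): e0; rewrite !inE ke kC !andbT /= => /negbFE/eqP <-.
    by rewrite ke kC.
  by move/setP/(_ j): e0; rewrite !inE ji.
apply/minsetP; split=> // D covD DC; apply/eqP; rewrite finset.eqEsubset DC.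
apply/fintype.subsetP => i /minC[e eE eCi].
have /set0Pn[k] := forall_inP covD e eE; rewrite inE => /andP[ke kD].
by move/setP/(_ k): eCi; rewrite !inE ke (fintype.subsetP DC) //= => /esym/eqP <-.
Qed.

Lemma dual_sub_cover D : vertex_cover E D ->
  exists2 C, C \in dual_hypergraph E & C \subset D.
Proof. by case/minset_exists => C minC CD; exists C; rewrite // inE. Qed.

Lemma vertex_coverT : vertex_cover E [set: 'I_n]%SET.
Proof. by apply/forall_inP => e /edges_nonempty; rewrite finset.setIT. Qed.

(** A list lets edges repeat; the last condition says that the product of its edges divides
    ['X_[m]]. *)
Definition packs q m := exists s : seq {set 'I_n},
  [/\ {subset s <= E}, size s = q &
      forall i, (count (fun e => i \in e) s <= m i)%N].

Lemma packs_up q : upward_closed (packs q).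
Proof.
move=> a m [s [sE sz sm]]; exists s; split=> // i.
by rewrite mnmDE (leq_trans (sm i)) ?leq_addl.
Qed.

Lemma edge_ideal_monomial :
  edge_ideal K E = monomial_ideal (packs 1).
Proof.
have eX e : \prod_(i in e) 'X_i = 'X_[mesym1 e] :> {mpoly K[n]}.
  rewrite mprodXE; congr 'X_[_]; apply/mnmP => i; rewrite mnm_sumE mnmE.
  have [ie|ie] := boolP (i \in e).
    rewrite (bigD1 i) //= mnm1E eqxx big1 // => j /andP[_ ji].
    by rewrite mnm1E (negbTE ji).
  by rewrite big1 // => j je; rewrite mnm1E; case: eqP => // ji; rewrite -ji je in ie.
apply/seteqP; split.
  apply: ideal_gen_sub; first exact: monomial_ideal_is_ideal (@packs_up 1).
  move=> _ [e eE ->]; rewrite eX; apply/monomial_idealX; exists [:: e].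
  split=> // [e'|i]; first by rewrite inE => /eqP ->.
  by rewrite mnmE /= addn0.
apply: monomial_ideal_sub; first exact: ideal_gen_is_ideal.
move=> m [[|e [|? ?]] [] // sE _ sm].
have em : (mesym1 e <= m)%MM.
  by apply/mnm_lepP => i; rewrite mnmE; have := sm i; rewrite /= addn0.
rewrite -(submK em) mpolyXD.
have [_ _ IM] := ideal_gen_is_ideal
  [set f : {mpoly K[n]} | exists2 e, e \in E & f = \prod_(i in e) 'X_i].
apply: IM; apply: sub_gen_smallest; exists e; last by rewrite eX.
by apply: sE; rewrite mem_head.
Qed.

Lemma packsD p q a b : packs p a -> packs q b -> packs (p + q) (a + b)%MM.
Proof.
move=> [s [sE sp sa]] [t [tE tq tb]]; exists (s ++ t); split.
- by move=> e; rewrite mem_cat => /orP[/sE|/tE].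
- by rewrite size_cat sp tq.
- by move=> i; rewrite count_cat mnmDE leq_add.
Qed.

Lemma packsS q m : packs q.+1 m <->
  exists a b, [/\ packs 1 a, packs q b & m = (a + b)%MM].
Proof.
split=> [|[a [b [Pa Pb ->]]]]; last by rewrite -add1n; apply: packsD.
move=> [[|e s] [] // sE [sq] sm].
have em : (mesym1 e <= m)%MM.
  apply/mnm_lepP => i; rewrite mnmE.
  by apply: leq_trans (sm i); rewrite /= leq_addr.
exists (mesym1 e), (m - mesym1 e)%MM; split; last by rewrite addmC submK.
  exists [:: e]; split=> // [e'|i]; last by rewrite mnmE /= addn0.
  by rewrite inE => /eqP ->; apply: sE; rewrite mem_head.
exists s; split=> // [e' e's|i]; first by apply: sE; rewrite inE e's orbT.
by rewrite mnmBE mnmE leq_subRL ?(sm i) //; apply: leq_trans (sm i); rewrite leq_addr.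
Qed.

Lemma edge_ideal_pow q : ideal_pow (edge_ideal K E) q = monomial_ideal (packs q).
Proof.
elim: q => [|q IHq].
  by apply/seteqP; split=> // f _ m _; exists [::]; split.
rewrite /ideal_pow iterS [iter q _ _]IHq edge_ideal_monomial.
rewrite ideal_mul_monomial; last exact: packs_up.
by apply: eq_monomial_ideal => m; split=> /packsS.
Qed.

(** For the converse, consider the vertices of exponent 0 in [m]. If they meet all edges, a minimal
    cover among them has weight 0 in [m]; otherwise some edge avoids them and divides the
    monomial. *)
Lemma packs1_kcover m : packs 1 m <-> kcover (dual_hypergraph E) 1 m.
Proof.
split=> [[[|e [|? ?]] [] // sE _ sm] C /dual_hypergraphP[covC _]|cm].
  have eE : e \in E by apply: sE; rewrite mem_head.
  have /set0Pn[i] := forall_inP covC e eE; rewrite inE => /andP[ie iC].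
  apply/weight_gt0P; exists i => //.
  by apply: leq_trans (sm i); rewrite /= ie.
have [cov|] := boolP (vertex_cover E [set i | m i == 0%N]%SET).
  have [C Cd Csub] := dual_sub_cover cov.
  have /weight_gt0P[i iC] := cm C Cd.
  by have := fintype.subsetP Csub i iC; rewrite inE => /eqP ->.
rewrite negb_forall_in => /exists_inP[e eE]; rewrite negbK => /eqP e0.
exists [:: e]; split=> // [e'|i]; first by rewrite inE => /eqP ->.
rewrite /= addn0; case: (boolP (i \in e)) => //= ie.
by move/setP/(_ i): e0; rewrite !inE ie /= lt0n => ->.
Qed.

Lemma edge_ideal_cover f :
  edge_ideal K E f <-> forall C, C \in dual_hypergraph E -> cover_prime K C f.
Proof.
rewrite edge_ideal_monomial; split=> [If C Cd m /If/packs1_kcover|Cf m fm].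
  exact.
by apply/packs1_kcover => C Cd; apply: Cf fm.
Qed.

Lemma edge_ideal_is_ideal : is_ideal (edge_ideal K E).
Proof. exact: ideal_gen_is_ideal. Qed.

Lemma assoc_primes_edge_ideal :
  assoc_primes (edge_ideal K E) =
  [set P | exists2 C, C \in dual_hypergraph E & P = cover_prime K C].
Proof.
apply/seteqP; split=> P.
  move=> [Pprime [f Pf]]; have [_ _ PM] := Pprime.
  have [P_ideal P1 _] := Pprime.
  have fP a : P a = edge_ideal K E (a * f) by rewrite Pf.
  (* In the first case [P] equals the prime of [C]: if [a * f] lies in the edge ideal, it lies in
     that prime, which does not contain [f]. *)
  have [[C Cd CP]|noC] := pselect
    (exists2 C, C \in dual_hypergraph E & ~ cover_prime K C f /\ cover_prime K C `<=` P).
    case: CP => nCf CP; exists C => //; apply/seteqP; split=> // a.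
    rewrite fP => /edge_ideal_cover /(_ C Cd).
    by have [_ _ CM] := cover_prime_prime K C; move/CM => [].
  (* Otherwise each [C] has a multiplier outside [P] sending [f] into its prime: 1 if [f] is already
     there, else an element of that prime outside [P]. The product of all multipliers sends [f] into
     the edge ideal, so it lies in the prime [P], a contradiction. *)
  have /choice[g gP] C : exists g, C \in dual_hypergraph E ->
      ~ P g /\ cover_prime K C (g * f).
    have [Cd|] := boolP (C \in dual_hypergraph E); last by exists 0.
    have [[C0 CD CM] _ _] := cover_prime_prime K C.
    have [Cf|nCf] := pselect (cover_prime K C f).
      by exists 1 => _; rewrite mul1r.
    have : ~ cover_prime K C `<=` P by move=> CP; apply: noC; exists C.
    move=> /existsNP[h /not_implyP[Ch nPh]]; exists h => _; split=> //.
    by rewrite mulrC; apply: CM.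
  have : P (\prod_(C <- enum (dual_hypergraph E)) g C).
    rewrite fP; apply/edge_ideal_cover => C Cd.
    rewrite (big_rem C) ?mem_enum //= mulrAC mulrC.
    by have [[_ _ CM] _ _] := cover_prime_prime K C; apply: CM; case: (gP C Cd).
  move=> /(prime_ideal_prod Pprime)[C]; rewrite mem_enum => Cd PgC.
  by case: (gP C Cd).
move=> [C /[dup] Cd /dual_hypergraphP[covC minC] ->]; split.
  exact: cover_prime_prime.
(* The witness is the product of the variables outside [C]. For [i] in [C], an edge meeting [C] only
   in [i] divides ['X_i] times this product. *)
exists 'X_[mesym1 (~: C)%SET]; apply/seteqP; split.
  apply: monomial_ideal_sub => [|m].
    have [I0 ID IM] := edge_ideal_is_ideal.
    split=> [|a b /= Ia Ib|a b /= Ib]; first by rewrite /= mul0r.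
      by rewrite mulrDl; apply: ID.
    by rewrite -mulrA; apply: IM.
  move=> /weight_gt0P[i iC mi] /=; rewrite -mpolyXD edge_ideal_monomial.
  apply/monomial_idealX; have [e eE eCi] := minC i iC.
  exists [:: e]; split=> // [e'|j]; first by rewrite inE => /eqP ->.
  rewrite /= addn0 mnmDE mnmE inE; case: (boolP (j \in C)) => jC /=.
    rewrite addn0; move/setP/(_ j): eCi; rewrite !inE jC andbT => ->.
    by case: eqP => [->|].
  by rewrite (leq_trans (leq_b1 _)) // leq_addl.
move=> a /edge_ideal_cover/(_ C Cd).
have [_ _ CM] := cover_prime_prime K C; move/CM => [//|/monomial_idealX].
move=> /weight_gt0P[i iC]; rewrite mnmE inE iC //.
Qed.

Lemma edge_ideal_symbolic_pow q :
  symbolic_pow (edge_ideal K E) q =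
  monomial_ideal (kcover (dual_hypergraph E) q).
Proof.
rewrite /symbolic_pow assoc_primes_edge_ideal; apply/seteqP; split=> f If.
  move=> m fm C Cd.
  by have := If (cover_prime K C) (ex_intro2 _ _ C Cd erefl); rewrite cover_prime_pow; apply.
by move=> _ [C Cd ->]; rewrite cover_prime_pow => m fm; apply: If fm _ Cd.
Qed.

Lemma cover_space_monomial H k :
  @cover_space K n H k = monomial_ideal (kcover H k).
Proof.
apply/seteqP; split.
  apply: smallest_sub => [|_ [c Hc ->]]; last exact/monomial_idealX.
  split=> [m|f g If Ig m /msuppD_le|a f If m /msuppZ_le]; last exact: If.
    by rewrite msupp0.
  by rewrite mem_cat => /orP[/If|/Ig].
move=> f If W [[W0 WD WZ] WX]; rewrite [f]mpolyE big_seq.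
elim/big_rec: _ => // m g fm Wg; apply: WD => //; apply: WZ; apply: WX.
by exists m => //; apply: If.
Qed.

Lemma symbolic_Rees_edge_ideal :
  symbolic_Rees (edge_ideal K E) = vertex_cover_algebra K (dual_hypergraph E).
Proof.
congr graded_sum; apply: funext => q.
by rewrite edge_ideal_symbolic_pow cover_space_monomial.
Qed.

(** By [packs1_kcover] the first symbolic power is the edge ideal itself, so the general criterion
    applies with [F 1] equal to it. *)
Lemma standard_graded_edge_ideal :
  standard_graded (symbolic_Rees (edge_ideal K E)) <->
  forall q, symbolic_pow (edge_ideal K E) q = ideal_pow (edge_ideal K E) q.
Proof.
have symb1 : symbolic_pow (edge_ideal K E) 1 = edge_ideal K E.
  rewrite edge_ideal_symbolic_pow edge_ideal_monomial.
  by apply: eq_monomial_ideal => m; split=> /packs1_kcover.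
rewrite -{3}symb1; apply: standard_graded_sumP.
- exact: symbolic_pow0.
- exact: symbolic_pow_is_ideal.
- exact: symbolic_powD.
Qed.

(** Every edge meets every minimal cover, so packing [q] edges always makes [m] a [q]-cover of the
    dual; only the converse is at stake. *)
Lemma symbolic_eq_ideal_powP :
  (forall q, symbolic_pow (edge_ideal K E) q = ideal_pow (edge_ideal K E) q) <->
  (forall q m, kcover (dual_hypergraph E) q m -> packs q m).
Proof.
have packs_kcover q m : packs q m -> kcover (dual_hypergraph E) q m.
  elim: q m => [|q IHq] m // /packsS[a [b [/packs1_kcover a1 /IHq bq ->]]] C Cd.
  by rewrite -/(weight C _) weightD -add1n leq_add ?a1 ?bq.
split=> [Ieq q m cm|kp q].
  have := monomial_idealX K (kcover (dual_hypergraph E) q) m.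
  by rewrite -edge_ideal_symbolic_pow Ieq edge_ideal_pow => -[_ /(_ cm)/monomial_idealX].
rewrite edge_ideal_symbolic_pow edge_ideal_pow.
by apply: eq_monomial_ideal => m; split=> [/kp|/packs_kcover].
Qed.

End EdgeIdealPowers.

(** * Integral supporting functionals of superadditive homogeneous functions *)

Lemma nat_maximum (P : nat -> Prop) b :
  (exists k, P k) -> (forall k, P k -> (k <= b)%N) ->
  exists k, P k /\ forall j, P j -> (j <= k)%N.
Proof.
move=> [k Pk] Pb.
have exP : exists k, `[< P k >] by exists k; apply/asboolP.
have ubP j : `[< P j >] -> (j <= b)%N by move/asboolP; apply: Pb.
case: (ex_maxnP exP ubP) => m /asboolP Pm maxm; exists m; split=> // j Pj.
by apply: maxm; apply/asboolP.
Qed.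

Section SupportingFunctional.
Variable n : nat.
Implicit Types (f g : 'X_{1..n} -> nat) (x y d u : 'X_{1..n}).

(** The third condition bounds the growth of [f], which keeps directional derivatives finite; like
    the other two, it passes to derivatives. *)
Definition gauge f := [/\ forall x y, (f x + f y <= f (x + y)%MM)%N,
  forall x N, f (x *+ N)%MM = (f x * N)%N &
  forall x y, (f (x + y)%MM <= mdeg x + f y)%N].

Definition additive_along f u := forall x, f (x + u)%MM = (f x + f u)%N.

(* [g x] is the limit, attained, of [f (x + N d) - N (f d)]: the directional
   derivative of [f] at [d] in the direction [x]. *)
Lemma gauge_derivative f d : gauge f -> exists g,
  [/\ gauge g, forall x, (f x <= g x)%N &
      forall u, u = d \/ additive_along f u -> additive_along g u /\ g u = f u].
Proof.
move=> [fD fM fL].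
(* [P x k] says that [k] is at most some difference quotient [f (x + N d) - N (f d)], stated without
   truncated subtraction. *)
pose P x k := exists N, (N * f d + k <= f (x + d *+ N)%MM)%N.
have mulmDr x N M : (x *+ (N + M) = x *+ N + x *+ M)%MM.
  by apply/mnmP => i; rewrite mnmDE !mulmnE mulnDr.
have mulmDl x y N : ((x + y) *+ N = x *+ N + y *+ N)%MM.
  by apply/mnmP => i; rewrite mnmDE !mulmnE mnmDE mulnDl.
have Pmono x k N M : (N * f d + k <= f (x + d *+ N)%MM)%N ->
    ((N + M) * f d + k <= f (x + d *+ (N + M))%MM)%N.
  move=> PN; rewrite mulmDr addmA; apply: leq_trans (fD _ _).
  by rewrite fM; lia.
have /choice[g gP] x : exists k, P x k /\ forall j, P x j -> (j <= k)%N.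
  apply: (@nat_maximum _ (mdeg x)); first by exists 0%N, 0%N; lia.
  by move=> k [N]; have := fL x (d *+ N)%MM; rewrite fM; lia.
have gP1 x : P x (g x) by case: (gP x).
have gmax x k : P x k -> (k <= g x)%N by case: (gP x) => _; apply.
have gD x y : (g x + g y <= g (x + y)%MM)%N.
  apply: gmax; have [N PN] := gP1 x; have [M PM] := gP1 y.
  exists (N + M)%N; rewrite mulmDr.
  have -> : (x + y + (d *+ N + d *+ M) = (x + d *+ N) + (y + d *+ M))%MM.
    by apply/mnmP => i; rewrite !mnmDE; lia.
  by apply: leq_trans (fD _ _); lia.
have fg x : (f x <= g x)%N.
  apply: gmax; exists 0%N; rewrite mul0n add0n.
  by apply: eq_leq; congr f; apply/mnmP => i; rewrite mnmDE mulmnE; lia.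
have g_le u : u = d \/ additive_along f u -> (g u <= f u)%N.
  have [N PN] := gP1 u; case=> [ud|fu]; move: PN; rewrite ?ud.
    have -> : (d + d *+ N = d *+ N.+1)%MM.
      by apply/mnmP => i; rewrite mnmDE !mulmnE; lia.
    by rewrite fM; lia.
  by rewrite addmC fu fM; lia.
exists g; split=> //.
  split=> // [x N|x y].
    case: N => [|N].
      suff : (g (x *+ 0)%MM <= 0)%N by lia.
      have [M] := gP1 (x *+ 0)%MM.
      have -> : (x *+ 0 + d *+ M = d *+ M)%MM.
        by apply/mnmP => i; rewrite mnmDE !mulmnE; lia.
      by rewrite fM; lia.
    apply/eqP; rewrite eqn_leq; apply/andP; split.
      (* The witness [M] is enlarged to a multiple of [N.+1], so that homogeneity of [f] lets the
         factor [N.+1] be divided out. *)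
      have [M PM] := gP1 (x *+ N.+1)%MM.
      have := Pmono _ _ _ (N * M)%N PM.
      have -> : (x *+ N.+1 + d *+ (M + N * M) = (x + d *+ M) *+ N.+1)%MM.
        by apply/mnmP => i; rewrite !(mnmDE, mulmnE); lia.
      rewrite fM => le1.
      suff : (f (x + d *+ M)%MM - M * f d <= g x)%N by nia.
      apply: gmax; exists M.
      by have := fD x (d *+ M)%MM; rewrite fM; lia.
    apply: gmax; have [M PM] := gP1 x; exists (M * N.+1)%N.
    have -> : (x *+ N.+1 + d *+ (M * N.+1) = (x + d *+ M) *+ N.+1)%MM.
      by apply/mnmP => i; rewrite !(mnmDE, mulmnE); lia.
    by rewrite fM; nia.
  have [N PN] := gP1 (x + y)%MM.
  suff : (g (x + y)%MM - mdeg x <= g y)%N by lia.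
  apply: gmax; exists N; have := fL x (y + d *+ N)%MM; rewrite addmA.
  have := fD y (d *+ N)%MM; rewrite fM; lia.
move=> u uP; have gu : g u = f u by apply/eqP; rewrite eqn_leq fg g_le.
split=> // x; apply/eqP; rewrite eqn_leq gD andbT gu.
suff : (g (x + u)%MM - f u <= g x)%N by lia.
(* For [u = d] the added [d] is absorbed as one more step, [N.+1]; along the other directions [f u]
   is split off by additivity of [f]. *)
apply: gmax; have [N] := gP1 (x + u)%MM; case: uP => [->|fu].
  have -> : (x + d + d *+ N = x + d *+ N.+1)%MM.
    by apply/mnmP => i; rewrite !(mnmDE, mulmnE); lia.
  exists N.+1; have := fD x (d *+ N.+1)%MM; rewrite fM; lia.
have -> : (x + u + d *+ N = x + d *+ N + u)%MM.
  by apply/mnmP => i; rewrite !(mnmDE, mulmnE); lia.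
rewrite fu; exists N; have := fD x (d *+ N)%MM; rewrite fM; lia.
Qed.

(** Derivatives are taken along [s] one after another; each keeps the earlier additive directions
    and the values on them. *)
Lemma gauge_additive_along f (s : seq 'X_{1..n}) : gauge f -> exists g,
  [/\ gauge g, forall x, (f x <= g x)%N,
      forall u, additive_along f u -> g u = f u &
      forall u, additive_along f u \/ u \in s -> additive_along g u].
Proof.
elim: s f => [|d s IHs] f gf.
  by exists f; split=> // u [].
have [g [gg fg gP]] := gauge_derivative d gf.
have [h [gh gh_le hE hA]] := IHs g gg; exists h; split=> //.
- by move=> x; apply: leq_trans (gh_le x).
- by move=> u fu; case: (gP u (or_intror fu)) => gu <-; apply: hE.
- move=> u [fu|]; first by apply: hA; left; case: (gP u (or_intror fu)).
  rewrite inE => /orP[/eqP ->|us]; apply: hA; last by right.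
  by left; case: (gP d (or_introl erefl)).
Qed.

(** Deriving at [c] first freezes the value there. Additivity along all unit vectors then makes the
    function linear, with coefficients its values at these vectors. *)
Lemma gauge_supporting_functional f c : gauge f -> exists z : 'I_n -> nat,
  (forall x, (f x <= \sum_i x i * z i)%N) /\ f c = (\sum_i c i * z i)%N.
Proof.
move=> gf; have [g [gg fg gP]] := gauge_derivative c gf.
have [gc gcE] := gP c (or_introl erefl).
have [h [[_ hM _] gh hE hA]] := gauge_additive_along [seq U_(i)%MM | i <- enum 'I_n] gg.
have hU i : additive_along h U_(i)%MM.
  by apply: hA; right; apply: map_f; rewrite mem_enum.
have hUM i x k : h (x + U_(i) *+ k)%MM = (h x + k * h U_(i)%MM)%N.
  elim: k => [|k IHk].
    by rewrite mul0n addn0; congr h; apply/mnmP => j; rewrite mnmDE mulmnE; lia.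
  have -> : (x + U_(i) *+ k.+1 = x + U_(i) *+ k + U_(i))%MM.
    by apply/mnmP => j; rewrite !(mnmDE, mulmnE); lia.
  by rewrite hU IHk; lia.
have h0 : h 0%MM = 0%N.
  have -> : (0 = 0 *+ 0 :> 'X_{1..n})%MM by apply/mnmP => i; rewrite mulmnE mnm0E.
  by rewrite hM muln0.
have hsum x : h x = (\sum_i x i * h U_(i)%MM)%N.
  rewrite {1}[x]multinomUE_id.
  by elim/big_rec2: _ => // i k y _ <-; rewrite addmC hUM; lia.
exists (fun i => h U_(i)%MM); split=> [x|]; rewrite -hsum.
  by apply: leq_trans (gh x).
by rewrite hE ?gcE.
Qed.

End SupportingFunctional.

(** * Packing numbers and covers *)

Section Packings.
Variables (n : nat) (E : {set {set 'I_n}}).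
Hypothesis edges_nonempty : forall e : {set 'I_n}, e \in E -> e != finset.set0.
Implicit Types (m x y : 'X_{1..n}).

Lemma packs_leq p q m : (p <= q)%N -> packs E q m -> packs E p m.
Proof.
move=> pq [s [sE sq sm]]; exists (take p s); split.
- by move=> e /mem_take/sE.
- by rewrite size_takel // sq.
- by move=> i; apply: leq_trans (sm i); rewrite -{2}(cat_take_drop p s) count_cat leq_addr.
Qed.

(** Each edge is nonempty and so uses at least one unit of the total degree. *)
Lemma packs_mdeg q m : packs E q m -> (q <= mdeg m)%N.
Proof.
move=> [s [sE <- sm]]; rewrite mdegE.
apply: (@leq_trans (\sum_(i < n) count (fun e : {set 'I_n} => i \in e) s)); last exact: leq_sum.
elim: s sE {sm} => [|e s IHs] sE //=; rewrite big_split /= -add1n leq_add //.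
  have /edges_nonempty/set0Pn[i ie] : e \in E by apply: sE; rewrite mem_head.
  by rewrite (bigD1 i) //= ie.
by apply: IHs => e' e's; apply: sE; rewrite inE e's orbT.
Qed.

Lemma packs_remove q m i : packs E q.+1 (m + U_(i))%MM -> packs E q m.
Proof.
move=> [s [sE sq sm]].
have [e es eP] : exists2 e, e \in s & i \in e \/ {in s, forall e' : {set 'I_n}, i \notin e'}.
  have [/hasP[e es ie]|/hasPn ns] := boolP (has (fun e : {set 'I_n} => i \in e) s).
    by exists e => //; left.
  by case: s sq ns {sE sm} => // e s _ ns; exists e; rewrite ?mem_head //; right.
exists (rem e s); split=> [e' /mem_rem/sE //||j]; first by rewrite size_rem // sq.
have := sm j; rewrite mnmDE mnm1E.
have /permP/(_ (fun e' : {set 'I_n} => j \in e')) -> := perm_to_rem es.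
rewrite /=; case: (eqVneq i j) => [<-|_]; last by lia.
case: eP => [-> |ns]; first by lia.
move=> _; suff -> : count (fun e' : {set 'I_n} => i \in e') (rem e s) = 0%N by [].
apply/eqP; rewrite -leqn0 leqNgt -has_count; apply/hasPn => e' /mem_rem.
exact: ns.
Qed.

Lemma packs_subn q x y : packs E q (x + y)%MM -> packs E (q - mdeg x) y.
Proof.
elim: {x}(mdeg x) {-2}x (erefl (mdeg x)) q y => [|d IHd] x xd q y.
  by move/eqP: xd; rewrite mdeg_eq0 => /eqP ->; rewrite add0m mdeg0 subn0.
have [i xi] : exists i, (0 < x i)%N.
  apply/existsP; rewrite -[[exists _, _]]negbK negb_exists.
  apply/negP => /forallP x0; move: xd; rewrite mdegE big1 // => i _.
  by apply/eqP; rewrite -leqn0 leqNgt x0.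
have Ux : (U_(i) <= x)%MM.
  by apply/mnm_lepP => j; rewrite mnm1E; case: eqP => // <-.
have xE := submK Ux; have x'd : mdeg (x - U_(i))%MM = d.
  by have := congr1 mdeg xE; rewrite mdegD mdeg1 xd addn1 => -[].
case: q => [|q] Pq; first by apply: (packs_leq (q := 0)) => //; exists [::].
rewrite xd subSS -x'd; apply: (IHd _ x'd); apply: (packs_remove (i := i)).
by rewrite -addmA (addmC y) addmA xE.
Qed.

Definition packing_number (nu : 'X_{1..n} -> nat) :=
  forall m, packs E (nu m) m /\ forall k, packs E k m -> (k <= nu m)%N.

Lemma packing_number_exists : exists nu, packing_number nu.
Proof.
suff /choice[nu nuP] : forall m, exists k,
    packs E k m /\ forall j, packs E j m -> (j <= k)%N by exists nu.
move=> m; apply: (@nat_maximum (fun k => packs E k m) (mdeg m)).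
  by exists 0%N, [::].
by move=> k /packs_mdeg.
Qed.

(** Concatenating packings gives superadditivity and one half of homogeneity. The hypothesis on
    multiples gives the other half, and [packs_subn] the growth bound. *)
Lemma packing_number_gauge nu : packing_number nu ->
  (forall m k q, packs E q (m *+ k.+1)%MM ->
     exists2 p, packs E p m & (q <= p * k.+1)%N) ->
  gauge nu.
Proof.
move=> nuP hom; have nu1 m : packs E (nu m) m by case: (nuP m).
have numax m k : packs E k m -> (k <= nu m)%N by case: (nuP m) => _; apply.
have nuD x y : (nu x + nu y <= nu (x + y)%MM)%N by apply/numax/packsD.
split=> // [x [|k]|x y].
- apply/eqP; rewrite muln0 -leqn0.
  by have := packs_mdeg (nu1 (x *+ 0)%MM); rewrite mdegMn muln0.
- apply/eqP; rewrite eqn_leq; apply/andP; split.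
    have [p /numax px] := hom _ _ _ (nu1 (x *+ k.+1)%MM).
    by move/leq_trans; apply; rewrite leq_mul2r px orbT.
  elim: k => [|k IHk].
    by rewrite muln1; apply: eq_leq; congr nu; apply/mnmP => i; rewrite mulmnE muln1.
  have -> : (x *+ k.+2 = x *+ k.+1 + x)%MM.
    by apply/mnmP => i; rewrite mnmDE !mulmnE; lia.
  by rewrite mulnS addnC; apply: leq_trans (nuD _ _); rewrite leq_add2r.
- by have /packs_subn/numax := nu1 (x + y)%MM; lia.
Qed.

(** A functional [z] dominating the packing number [nu] is positive on every edge, so its support
    contains a minimal cover [C]. Integrality of [z] gives [q <= weight C m <= <m, z> = nu m]. *)
Lemma packs_kcover_of_homogeneous :
  (forall m k q, packs E q (m *+ k.+1)%MM ->
     exists2 p, packs E p m & (q <= p * k.+1)%N) ->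
  forall q m, kcover (dual_hypergraph E) q m -> packs E q m.
Proof.
move=> hom q m qm; have [nu nuP] := packing_number_exists.
have [z [zle zm]] := gauge_supporting_functional m (packing_number_gauge nuP hom).
have covz : vertex_cover E [set i | (0 < z i)%N]%SET.
  apply/forall_inP => e eE.
  have /leq_trans/(_ (zle (mesym1 e))) : (0 < nu (mesym1 e))%N.
    case: (nuP (mesym1 e)) => _; apply; exists [:: e].
    split=> [e'|//|i]; first by rewrite inE => /eqP ->.
    by rewrite mnmE /= addn0.
  rewrite lt0n sum_nat_eq0 negb_forall => /existsP[i].
  rewrite implyTb muln_eq0 negb_or mnmE => /andP[ie zi].
  by apply/set0Pn; exists i; rewrite !inE lt0n zi andbT; case: (i \in e) ie.
have [C Cd Csub] := dual_sub_cover covz.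
case: (nuP m) => nuPm _; apply: packs_leq nuPm; rewrite zm.
apply: leq_trans (qm C Cd) _; rewrite big_mkcond leq_sum // => i _.
case: ifP => // /(fintype.subsetP Csub); rewrite inE => zi.
by rewrite leq_pmulr.
Qed.

End Packings.

(** * The dual linear programs and integral solutions *)

Section LinearProgramming.
Variables (R : realType) (n : nat) (E : {set {set 'I_n}}).
Hypothesis edges_nonempty : forall e : {set 'I_n}, e \in E -> e != finset.set0.
Implicit Types (s : seq {set 'I_n}).
Let A := incidence_mx R E.

(** The chain is [<1, y> <= <A^T z, y> = <A y, z> <= <c, z>]. *)
Lemma weak_duality c y z : max_feasible A c y -> min_feasible A z ->
  dotv (onev R #|E|) y <= dotv c z.
Proof.
move=> [y0 Ay] [z0 Az].
have dotAy : dotv (A^T *m z) y = dotv (A *m y) z.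
  rewrite /dotv.
  under eq_bigr => j _ do rewrite mxE mulr_suml.
  rewrite exchange_big; apply: eq_bigr => i _; rewrite mxE mulr_suml.
  by apply: eq_bigr => j _; rewrite mxE mulrAC.
apply: (@le_trans _ _ (dotv (A *m y) z)).
  rewrite -dotAy; apply: ler_sum => j _; apply: ler_wpM2r; last exact: Az.
  by have := y0 j; rewrite mxE.
apply: ler_sum => i _; apply: ler_wpM2r; last exact: Ay.
by have := z0 i; rewrite mxE.
Qed.

(** Lists of edges, up to order, correspond to nonnegative integral vectors, so packings become
    integral feasible points. *)
Definition multiplicity s : 'cV[R]_#|E| :=
  \col_j (count_mem (enum_val j) s)%:R.

Lemma sum_count_mem s (P : pred {set 'I_n}) : {subset s <= E} ->
  (\sum_(j < #|E|) P (enum_val j) * count_mem (enum_val j) s)%N = count P s.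
Proof.
elim: s => [|e s IHs] sE; first by rewrite big1 // => j _; rewrite muln0.
under eq_bigr => j _ do rewrite /= mulnDr.
rewrite big_split /= IHs => [|e' e's]; last by apply: sE; rewrite inE e's orbT.
have eE : e \in E by apply: sE; rewrite mem_head.
congr (_ + _)%N; rewrite (bigD1 (enum_rank_in eE e)) //= enum_rankK_in //.
rewrite eqxx muln1 big1 ?addn0 // => j.
rewrite -(inj_eq enum_val_inj) enum_rankK_in // eq_sym => /negbTE ->.
by rewrite muln0.
Qed.

Lemma dotv_multiplicity s : {subset s <= E} ->
  dotv (onev R #|E|) (multiplicity s) = (size s)%:R.
Proof.
move=> sE; rewrite -(count_predT s) -(sum_count_mem predT sE) natr_sum.
by apply: eq_bigr => j _; rewrite !mxE mul1r mul1n.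
Qed.

Lemma mul_incidence_multiplicity s i : {subset s <= E} ->
  (A *m multiplicity s) i 0 = (count (fun e : {set 'I_n} => i \in e) s)%:R.
Proof.
move=> sE; rewrite mxE -(sum_count_mem _ sE) natr_sum.
by apply: eq_bigr => j _; rewrite !mxE natrM.
Qed.

Lemma integral_multiplicity (y : 'cV[R]_#|E|) : lev 0 y -> integralv y ->
  exists2 s, {subset s <= E} & y = multiplicity s.
Proof.
move=> y0 yint.
have /choice[k yk] j : exists k, y j 0 = k%:R.
  by apply/natrP; rewrite -intrEge0 ?yint //; have := y0 j; rewrite mxE.
exists (flatten [seq nseq (k j) (enum_val j) | j <- enum 'I_#|E|]).
  move=> e /flatten_mapP[j _]; rewrite mem_nseq => /andP[_ /eqP ->].
  exact: enum_valP.
apply/colP => j; rewrite yk mxE count_flatten -map_comp sumnE big_map big_enum /=.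
rewrite (bigD1 j) //= count_nseq /= eqxx mul1n big1 ?addn0 // => i ij.
by rewrite count_nseq /= (inj_eq enum_val_inj) (negbTE ij).
Qed.

Lemma max_feasible_multiplicity s (m : 'X_{1..n}) : {subset s <= E} ->
  (forall i, (count (fun e : {set 'I_n} => i \in e) s <= m i)%N) <->
  max_feasible A (\col_i (m i)%:R) (multiplicity s).
Proof.
move=> sE; split=> [sm|[_ Am] i]; last first.
  by have := Am i; rewrite mul_incidence_multiplicity // mxE ler_nat.
split=> i; first by rewrite !mxE.
by rewrite mul_incidence_multiplicity // mxE ler_nat.
Qed.

(** The multiplicity vector of a packing into [m *+ k.+1], divided by [k.+1], is feasible for [m];
    its value is therefore at most the integral optimum for [m], which is the size of a packing. *)
Lemma packs_homogeneous : integral_dual_system R E ->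
  forall m k q, packs E q (m *+ k.+1)%MM ->
    exists2 p, packs E p m & (q <= p * k.+1)%N.
Proof.
move=> ids m k q [t [tE tq tm]].
have [[y [[yfeas ymax] yint]] _] := ids m.
have [y0 _] := yfeas.
have [s sE yE] := integral_multiplicity y0 yint.
exists (size s).
  by exists s; split=> //; apply/max_feasible_multiplicity; rewrite -?yE.
have k0 : 0 < k.+1%:R :> R by rewrite ltr0Sn.
have dotZ (u : 'cV[R]_#|E|) a : dotv (onev R #|E|) (a *: u) = a * dotv (onev R #|E|) u.
  by rewrite /dotv mulr_sumr; apply: eq_bigr => j _; rewrite !mxE mulrCA.
have : dotv (onev R #|E|) (k.+1%:R^-1 *: multiplicity t) <= dotv (onev R #|E|) y.
  apply: ymax; split=> i.
    by rewrite !mxE mulr_ge0 // invr_ge0 ltW.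
  rewrite -scalemxAr mxE mul_incidence_multiplicity // mxE ler_pdivrMl //.
  by rewrite -natrM ler_nat mulnC; have := tm i; rewrite mulmnE.
rewrite dotZ yE !dotv_multiplicity // tq ler_pdivrMl // -natrM ler_nat.
by rewrite mulnC.
Qed.

Lemma integral_dual_system_of_packs :
  (forall q m, kcover (dual_hypergraph E) q m -> packs E q m) ->
  integral_dual_system R E.
Proof.
move=> kp c; set m : 'X_{1..n} := [multinom c i | i < n].
have cm : \col_i (c i)%:R = \col_i (m i)%:R :> 'cV[R]_n.
  by apply/colP => i; rewrite !mxE mnmE.
rewrite /= cm.
(* The whole vertex set is a cover, so minimal covers exist. The least weight among them will be the
   common optimum, reached by a packing and by the indicator of [C]. *)
have [C0 C0d _] := dual_sub_cover (vertex_coverT edges_nonempty).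
have [C Cd Cmin] := arg_minnP (fun C => weight C m) C0d.
have [s [sE sq sm]] : packs E (weight C m) m by apply: kp.
have yfeas : max_feasible A (\col_i (m i)%:R) (multiplicity s).
  exact/max_feasible_multiplicity.
pose z : 'cV[R]_n := \col_i (i \in C)%:R.
have zfeas : min_feasible A z.
  split=> [i|j]; first by rewrite !mxE.
  have [/forall_inP covC _] := dual_hypergraphP _ _ Cd.
  have /set0Pn[i] := covC _ (enum_valP j); rewrite inE => /andP[ij iC].
  rewrite !mxE (bigD1 i) //= !mxE ij iC mulr1 lerDl sumr_ge0 // => k _.
  by rewrite !mxE mulr_ge0.
have yz : dotv (onev R #|E|) (multiplicity s) = dotv (\col_i (m i)%:R) z.
  rewrite dotv_multiplicity // sq natr_sum big_mkcond; apply: eq_bigr => i _.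
  by rewrite !mxE; case: ifP; rewrite ?mulr1 ?mulr0.
split.
  exists (multiplicity s); split; last by move=> j; rewrite mxE.
  by split=> // y' /weak_duality/(_ zfeas); rewrite yz.
exists z; split; last by move=> i; rewrite mxE.
by split=> // z' /(weak_duality yfeas); rewrite yz.
Qed.

End LinearProgramming.

Theorem theorem5p10 (R : realType) (K : fieldType) (n : nat)
  (E : {set {set 'I_n}})
  (E_simple : simple_hypergraph E)
  (edges_nonempty : forall e : {set 'I_n}, e \in E -> e != finset.set0) :
  symbolic_Rees (edge_ideal K E) = vertex_cover_algebra K (dual_hypergraph E) /\
  (integral_dual_system R E <->
     standard_graded (symbolic_Rees (edge_ideal K E))) /\
  (standard_graded (symbolic_Rees (edge_ideal K E)) <->
     forall q : nat,
       symbolic_pow (edge_ideal K E) q = ideal_pow (edge_ideal K E) q).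
Proof.
split; first exact: symbolic_Rees_edge_ideal.
have graded := standard_graded_edge_ideal K E.
split=> //; apply: iff_trans (iff_sym graded).
(* Integrality is compared with the purely combinatorial form of (3): every [q]-cover of the dual
   packs [q] edges. *)
apply: iff_trans (iff_sym (symbolic_eq_ideal_powP K E)).
split=> [/packs_homogeneous|]; first exact: packs_kcover_of_homogeneous.
exact: integral_dual_system_of_packs.
Qed.
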